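(* Consider the $D_4^{(1)}$ system (defined in the context) restricted to parameters with $\alpha_4=\alpha_1$, and set $\beta_0:=\alpha_0$, $\beta_1:=\alpha_3$, $\beta_2:=\alpha_2$, $\beta_3:=\alpha_1$, so that $\beta_0+\beta_1+2\beta_2+2\beta_3=1$. This system has the following invariant divisors: if $\beta_0=0$, then $f_0:=x-\eta$ is an invariant divisor; if $\beta_1=0$, then $f_1:=y-1$ is; if $\beta_2=0$, then $f_2:=z$ is; if $\beta_3=0$, then $f_3:=xy$ is.
   Context: A polynomial $f$ in $x,y,z$ is an invariant divisor of a polynomial system if the derivative $df/dt$ along the system equals $f$ times a polynomial in $x,y,z$ (with coefficients in $\mathbb{C}(t)$). The $D_4^{(1)}$ system. Let $\eta\in\mathbb{C}\setminus\{0\}$, let $b(t)\in\mathbb{C}(t)$ be nonzero, and let $\alpha_0,\dots,\alpha_4\in\mathbb{C}$ satisfy $\alpha_0+\alpha_1+2\alpha_2+\alpha_3+\alpha_4=1$. The $D_4^{(1)}$ system for unknown functions $x,y,z$ of $t$ is $$\frac{2\eta}{b(t)}\frac{dx}{dt}=P,\qquad -\frac{2\eta}{b(t)}\frac{dy}{dt}=Q,\qquad \frac{2\eta}{b(t)}\frac{dz}{dt}=R,$$ where $P=-2x(y-1)yz(x-\eta)(2x-2y+1-\eta)-2(2\alpha_0+2\alpha_1+4\alpha_2+\alpha_3+\alpha_4)x^3y-2(\alpha_0+\alpha_1)xy^3+(5\alpha_0+5\alpha_1+6\alpha_2+\alpha_3+\alpha_4)x^2y^2-\{5\alpha_0+5\alpha_1+6\alpha_2+2\alpha_3-3(2\alpha_0+2\alpha_1+4\alpha_2+\alpha_3+\alpha_4)\eta\}x^2y+\{3(\alpha_0+\alpha_1)-(4\alpha_0+6\alpha_1+6\alpha_2+\alpha_3+\alpha_4)\eta\}xy^2+x^4+2(\alpha_0+\alpha_1+2\alpha_2+\alpha_3-\eta)x^3+2\alpha_1\eta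 y^3+\{(\alpha_0+\alpha_1+2\alpha_2+\alpha_3)(\eta^2-3\eta+1)+\alpha_4\eta^2\}x^2+\alpha_1(\eta-3)\eta y^2+\{-(\alpha_0+\alpha_1)+2(2\alpha_0+3\alpha_1+3\alpha_2+\alpha_3)\eta-(2\alpha_0+2\alpha_1+4\alpha_2+\alpha_3+\alpha_4)\eta^2\}xy+(\alpha_0+\alpha_1+2\alpha_2+\alpha_3)(\eta-1)\eta x-\alpha_1(\eta-1)\eta y$, $Q=2x(y-1)yz(x-\eta)(2x-2y+1-\eta)-2(\alpha_3+\alpha_4)x^3y-2(\alpha_0+\alpha_1+4\alpha_2+2\alpha_3+2\alpha_4)xy^3+(\alpha_0+\alpha_1+6\alpha_2+5\alpha_3+5\alpha_4)x^2y^2+\{-(\alpha_0+\alpha_1+6\alpha_2+4\alpha_3+6\alpha_4)+3(\alpha_3+\alpha_4)\eta\}x^2y+\{3(\alpha_0+\alpha_1+4\alpha_2+2\alpha_3+2\alpha_4)-(2\alpha_0+6\alpha_2+5\alpha_3+5\alpha_4)\eta\}xy^2+y^4+2\alpha_4x^3+2\{(\alpha_0+2\alpha_2+\alpha_3+\alpha_4)\eta-1\}y^3-\alpha_4(3\eta-1)x^2+\{1-3(\alpha_0+2\alpha_2+\alpha_3+\alpha_4)\eta+(\alpha_0+2\alpha_2+\alpha_3+\alpha_4)\eta^2\}y^2+\{-(\alpha_0+\alpha_1+4\alpha_2+2\alpha_3+2\alpha_4)+2(\alpha_0+3\alpha_2+2\alpha_3+3\alpha_4)\eta-(\alpha_3+\alpha_4)\eta^2\}xy+\alpha_4(\eta-1)\eta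 x-(\alpha_0+2\alpha_2+\alpha_3+\alpha_4)(\eta-1)\eta y$, $R=(2x-2y+1-\eta)\{2x^2y+2xy^2-x^2-\eta y^2-2(\eta+1)xy+\eta(x+y)\}z^2+z\big[-2(\alpha_3+\alpha_4)x^3+2(\alpha_0+\alpha_1)y^3+2(\alpha_0+\alpha_1+6\alpha_2+2\alpha_3+2\alpha_4)x^2y-2(2\alpha_0+2\alpha_1+6\alpha_2+\alpha_3+\alpha_4)xy^2+\{-(\alpha_0+\alpha_1+6\alpha_2+4\alpha_3)+3(\alpha_3+\alpha_4)\eta\}x^2+\{-3(\alpha_0+\alpha_1)+(4\alpha_0+6\alpha_2+\alpha_3+\alpha_4)\eta\}y^2-4\{-(\alpha_0+\alpha_1+3\alpha_2+\alpha_3)+(\alpha_0+3\alpha_2+\alpha_3+\alpha_4)\eta\}xy+\{-(\alpha_0+\alpha_1+4\alpha_2+2\alpha_3)+2(\alpha_0+3\alpha_2+2\alpha_3)\eta-(\alpha_3+\alpha_4)\eta^2\}x+\{\alpha_0+\alpha_1-2(2\alpha_0+3\alpha_2+\alpha_3)\eta+(2\alpha_0+4\alpha_2+\alpha_3+\alpha_4)\eta^2\}y-(\alpha_0+2\alpha_2+\alpha_3)(\eta-1)\eta\big]+\alpha_2\big[(\alpha_0+\alpha_1+2\alpha_2-\alpha_3-\alpha_4)x^2+(\alpha_0+\alpha_1-2\alpha_2-\alpha_3-\alpha_4)y^2-2(\alpha_0+\alpha_1-\alpha_3-\alpha_4)xy+\{\alpha_0+\alpha_1-2\alpha_3-(2\alpha_0+2\alpha_2-\alpha_3-\alpha_4)\eta\}x+\{-\alpha_0-\alpha_1+2\alpha_2+2\alpha_3+(2\alpha_0-\alpha_3-\alpha_4)\eta\}y+(\eta-1)(\alpha_2+\alpha_3+(\alpha_0+\alpha_2)\eta)\big]$.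 *)

(* Defs.v *)
From HB Require Import structures.
From mathcomp Require Import all_boot all_order all_algebra ring.
From mathcomp Require Import generic_quotient fraction complex reals mpoly.

Set Implicit Arguments.
Unset Strict Implicit.
Unset Printing Implicit Defensive.

Import GRing.Theory.
Local Open Scope ring_scope.
Local Open Scope quotient_scope.

Notation "x %:F" := (@FracField.tofrac _ x).

Notation ratfun k := {fraction {poly k}}.

Lemma frac_reprM (D : idomainType) (u : {fraction D}) :
  u * (\d_(repr u))%:F = (\n_(repr u))%:F.
Proof.
have H (r : {ratio D}) :
    FracField.mul (\pi_(FracField.type D) r) (\d_r)%:F = (\n_r)%:F.
  rewrite !piE; apply/eqmodP; rewrite /= FracField.equivfE /FracField.mulf.
  rewrite !numden_Ratio ?mulr1 ?mul1r ?oner_neq0 ?mulf_neq0 ?denom_ratioP //.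
  by rewrite mulrC.
by rewrite -[RHS]H reprK.
Qed.

Section RationalFunctions.
Variable k : fieldType.
Implicit Types (p q : {poly k}) (u w : ratfun k).

(* d/dt on k(t), by the quotient rule on a chosen representative;
   [ratderiv_frac] shows that the choice is irrelevant. *)
Definition ratderiv u : ratfun k :=
  let r := repr u in
  ((\n_r)^`() * \d_r - \n_r * (\d_r)^`())%:F / ((\d_r) ^+ 2)%:F.

Definition ratconst (c : k) : ratfun k := (c%:P)%:F.

Lemma ratfun_repr u : u = (\n_(repr u))%:F / (\d_(repr u))%:F.
Proof.
by rewrite -frac_reprM mulfK // tofrac_eq0 denom_ratioP.
Qed.

Lemma ratderiv_frac p q : q != 0 ->
  ratderiv (p%:F / q%:F) = (p^`() * q - p * q^`())%:F / (q ^+ 2)%:F.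
Proof.
move=> q0; set u := _ / _; rewrite /ratderiv.
have d0 := denom_ratioP (repr u).
have := ratfun_repr u; move: d0.
set n := \n_ _; set d := \d_ _ => d0 uE.
have qF : q%:F != 0 :> ratfun k by rewrite tofrac_eq0.
have dF : d%:F != 0 :> ratfun k by rewrite tofrac_eq0.
have e1 : p * d = n * q.
  have crossM (F : fieldType) (a b c e : F) :
      b != 0 -> e != 0 -> a / b = c / e -> a * e = c * b.
    by move=> b0 e0 /eqP; rewrite eqr_div // => /eqP.
  apply/eqP; rewrite -tofrac_eq !tofracM; apply/eqP.
  exact: crossM qF dF uE.
have e2 : p^`() * d + p * d^`() = n^`() * q + n * q^`().
  by rewrite -!derivM e1.
apply/eqP; rewrite eqr_div ?tofrac_eq0 ?expf_neq0 // -!tofracM tofrac_eq.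
apply/eqP.
have -> : (n^`() * d - n * d^`()) * q ^+ 2 =
  d * q * (n^`() * q + n * q^`()) - (n * q) * (d * q^`() + d^`() * q) by ring.
by rewrite -e2 -e1; ring.
Qed.

End RationalFunctions.

(* A system dx/dt = v_0, dy/dt = v_1, dz/dt = v_2 over k(t), where x, y, z are
   'X_0, 'X_1, 'X_2. *)
Definition polysys (k : fieldType) := (3.-tuple {mpoly (ratfun k)[3]})%type.

(* Chain rule: the coefficients of f depend on t as well. *)
Definition sysderiv (k : fieldType) (v : polysys k)
    (f : {mpoly (ratfun k)[3]}) : {mpoly (ratfun k)[3]} :=
  map_mpoly (@ratderiv k) f + \sum_(i < 3) mderiv i f * tnth v i.

Definition invariant_divisor (k : fieldType) (v : polysys k)
    (f : {mpoly (ratfun k)[3]}) : Prop :=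
  exists g : {mpoly (ratfun k)[3]}, sysderiv v f = f * g.

Section D4Polynomials.
Variable A : comNzRingType.
Variables eta a0 a1 a2 a3 a4 x y z : A.

Definition D4P : A :=
  - 2 * x * (y - 1) * y * z * (x - eta) * (2 * x - 2 * y + 1 - eta)
  - 2 * (2 * a0 + 2 * a1 + 4 * a2 + a3 + a4) * x ^+ 3 * y
  - 2 * (a0 + a1) * x * y ^+ 3
  + (5 * a0 + 5 * a1 + 6 * a2 + a3 + a4) * x ^+ 2 * y ^+ 2
  - (5 * a0 + 5 * a1 + 6 * a2 + 2 * a3
     - 3 * (2 * a0 + 2 * a1 + 4 * a2 + a3 + a4) * eta) * x ^+ 2 * y
  + (3 * (a0 + a1) - (4 * a0 + 6 * a1 + 6 * a2 + a3 + a4) * eta) * x * y ^+ 2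
  + x ^+ 4
  + 2 * (a0 + a1 + 2 * a2 + a3 - eta) * x ^+ 3
  + 2 * a1 * eta * y ^+ 3
  + ((a0 + a1 + 2 * a2 + a3) * (eta ^+ 2 - 3 * eta + 1) + a4 * eta ^+ 2)
    * x ^+ 2
  + a1 * (eta - 3) * eta * y ^+ 2
  + (- (a0 + a1) + 2 * (2 * a0 + 3 * a1 + 3 * a2 + a3) * eta
     - (2 * a0 + 2 * a1 + 4 * a2 + a3 + a4) * eta ^+ 2) * x * y
  + (a0 + a1 + 2 * a2 + a3) * (eta - 1) * eta * x
  - a1 * (eta - 1) * eta * y.

Definition D4Q : A :=
  2 * x * (y - 1) * y * z * (x - eta) * (2 * x - 2 * y + 1 - eta)
  - 2 * (a3 + a4) * x ^+ 3 * y
  - 2 * (a0 + a1 + 4 * a2 + 2 * a3 + 2 * a4) * x * y ^+ 3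
  + (a0 + a1 + 6 * a2 + 5 * a3 + 5 * a4) * x ^+ 2 * y ^+ 2
  + (- (a0 + a1 + 6 * a2 + 4 * a3 + 6 * a4) + 3 * (a3 + a4) * eta)
    * x ^+ 2 * y
  + (3 * (a0 + a1 + 4 * a2 + 2 * a3 + 2 * a4)
     - (2 * a0 + 6 * a2 + 5 * a3 + 5 * a4) * eta) * x * y ^+ 2
  + y ^+ 4
  + 2 * a4 * x ^+ 3
  + 2 * ((a0 + 2 * a2 + a3 + a4) * eta - 1) * y ^+ 3
  - a4 * (3 * eta - 1) * x ^+ 2
  + (1 - 3 * (a0 + 2 * a2 + a3 + a4) * eta
     + (a0 + 2 * a2 + a3 + a4) * eta ^+ 2) * y ^+ 2
  + (- (a0 + a1 + 4 * a2 + 2 * a3 + 2 * a4)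
     + 2 * (a0 + 3 * a2 + 2 * a3 + 3 * a4) * eta
     - (a3 + a4) * eta ^+ 2) * x * y
  + a4 * (eta - 1) * eta * x
  - (a0 + 2 * a2 + a3 + a4) * (eta - 1) * eta * y.

Definition D4R : A :=
  (2 * x - 2 * y + 1 - eta)
  * (2 * x ^+ 2 * y + 2 * x * y ^+ 2 - x ^+ 2 - eta * y ^+ 2
     - 2 * (eta + 1) * x * y + eta * (x + y)) * z ^+ 2
  + z * (- 2 * (a3 + a4) * x ^+ 3
         + 2 * (a0 + a1) * y ^+ 3
         + 2 * (a0 + a1 + 6 * a2 + 2 * a3 + 2 * a4) * x ^+ 2 * y
         - 2 * (2 * a0 + 2 * a1 + 6 * a2 + a3 + a4) * x * y ^+ 2
         + (- (a0 + a1 + 6 * a2 + 4 * a3) + 3 * (a3 + a4) * eta) * x ^+ 2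
         + (- 3 * (a0 + a1) + (4 * a0 + 6 * a2 + a3 + a4) * eta) * y ^+ 2
         - 4 * (- (a0 + a1 + 3 * a2 + a3) + (a0 + 3 * a2 + a3 + a4) * eta)
           * x * y
         + (- (a0 + a1 + 4 * a2 + 2 * a3)
            + 2 * (a0 + 3 * a2 + 2 * a3) * eta
            - (a3 + a4) * eta ^+ 2) * x
         + (a0 + a1 - 2 * (2 * a0 + 3 * a2 + a3) * eta
            + (2 * a0 + 4 * a2 + a3 + a4) * eta ^+ 2) * y
         - (a0 + 2 * a2 + a3) * (eta - 1) * eta)
  + a2 * ((a0 + a1 + 2 * a2 - a3 - a4) * x ^+ 2
          + (a0 + a1 - 2 * a2 - a3 - a4) * y ^+ 2
          - 2 * (a0 + a1 - a3 - a4) * x * y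
          + (a0 + a1 - 2 * a3 - (2 * a0 + 2 * a2 - a3 - a4) * eta) * x
          + (- a0 - a1 + 2 * a2 + 2 * a3 + (2 * a0 - a3 - a4) * eta) * y
          + (eta - 1) * (a2 + a3 + (a0 + a2) * eta)).

End D4Polynomials.

(* (2 eta / b) dx/dt = P, - (2 eta / b) dy/dt = Q, (2 eta / b) dz/dt = R,
   solved for the derivatives; meaningful for eta != 0 and b != 0. *)
Definition D4sys (k : fieldType) (eta : k) (b : ratfun k)
    (a0 a1 a2 a3 a4 : k) : polysys k :=
  let K c : {mpoly (ratfun k)[3]} := (ratconst c)%:MP in
  let s := b / (2 * ratconst eta) in
  let ev (F : forall A : comNzRingType,
              A -> A -> A -> A -> A -> A -> A -> A -> A -> A) :=
    F {mpoly (ratfun k)[3]} (K eta) (K a0) (K a1) (K a2) (K a3) (K a4)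
      'X_0 'X_1 'X_2 in
  [tuple s *: ev D4P; - s *: ev D4Q; s *: ev D4R].

(* Main.v *)
From HB Require Import structures.
Require Import Defs.
From mathcomp Require Import all_boot all_order all_algebra ring.
From mathcomp Require Import fraction complex reals mpoly.

Set Implicit Arguments.
Unset Strict Implicit.
Unset Printing Implicit Defensive.

(** Each [f_i] has complex coefficients, so the coefficientwise part of its
    derivative along the system vanishes and only the chain-rule part is left
    ([sysderiv_const]).  Hence a divisor [w - c], with [w] a coordinate and [c]
    a complex number, has as derivative the component of the system along [w],
    and it is invariant as soon as this component is a multiple of [w - c]
    ([invariant_coord]); by the Leibniz rule, [x y] is invariant as soon as
    each of the two components is a multiple of its own coordinate
    ([invariant_coordM]).

    So the question is whether a component vanishes when [w] is specialised to
    [c].  Reading [P], [Q] or [R] as a univariate polynomial in [w], the factor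
    theorem turns a root [c] into a factor [w - c] without any quotient being
    computed ([horner_factor]).  The root itself is a direct evaluation: [P] at
    [x = eta] and [Q] at [y = 1] vanish thanks to the linear relation between
    the parameters, whereas [R] at [z = 0], [P] at [x = 0] and [Q] at [y = 0]
    have the factors [alpha_2], [alpha_1] and [alpha_4]. The identification
    [alpha_4 = alpha_1] makes the last two vanish together. *)

Import GRing.Theory.
Local Open Scope ring_scope.

(** * Derivatives along a system of polynomials with constant coefficients *)

Section ConstantCoefficients.
Variable k : fieldType.

(** The embedding of constants is a ring morphism, so a polynomial with constant
    coefficients can be presented as an image under [map_mpoly ratconst]. *)
HB.instance Definition _ := GRing.RMorphism.copy (@ratconst k)
  (@FracField.tofrac {poly k} \o polyC).

Lemma ratderiv_const (c : k) : ratderiv (ratconst c) = 0.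
Proof.
rewrite -[ratconst c]divr1 -(rmorph1 (@FracField.tofrac {poly k})).
rewrite ratderiv_frac ?oner_neq0 // !derivC.
by rewrite mul0r mulr0 subrr rmorph0 mul0r.
Qed.

Lemma map_ratderiv_const n (h : {mpoly k[n]}) :
  map_mpoly (@ratderiv k) (map_mpoly (@ratconst k) h) = 0.
Proof.
rewrite {1}/map_mpoly /mmap big1 // => m _ /=.
by rewrite mcoeff_map_mpoly ratderiv_const mpolyC0 mul0r.
Qed.

(** Differentiation of coefficients kills constants, which leaves the
    chain-rule part. *)
Lemma sysderiv_const (v : polysys k) (h : {mpoly k[3]}) :
  sysderiv v (map_mpoly (@ratconst k) h) =
  \sum_(i < 3) mderiv i (map_mpoly (@ratconst k) h) * tnth v i.
Proof. by rewrite /sysderiv map_ratderiv_const add0r. Qed.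

Lemma sum_mderivX (v : polysys k) (i : 'I_3) :
  \sum_(j < 3) mderiv j 'X_i * tnth v j = tnth v i.
Proof.
rewrite (bigD1 i) //= big1 => [|j /negPf ji]; last first.
  by rewrite mderivX mnm1E eq_sym ji scale0r mul0r.
rewrite mderivX mnm1E eqxx scale1r.
by rewrite -[X in (X - _)%MM]add0m addmK mpolyX0 mul1r addr0.
Qed.

(** Subtracting an arbitrary constant covers [x - eta], [y - 1] and [z - 0]
    at once. *)
Lemma sysderiv_coord (v : polysys k) (i : 'I_3) (c : k) :
  sysderiv v ('X_i - (ratconst c)%:MP) = tnth v i.
Proof.
rewrite -(map_mpolyC 3 (@ratconst k)) -(map_mpolyX (@ratconst k) U_(i)).
rewrite -rmorphB sysderiv_const -[RHS]sum_mderivX; apply: eq_bigr => j _.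
by rewrite rmorphB /= map_mpolyX map_mpolyC mderivB mderivC subr0.
Qed.

Lemma sysderiv_coordM (v : polysys k) (i j : 'I_3) :
  sysderiv v ('X_i * 'X_j) = tnth v i * 'X_j + 'X_i * tnth v j.
Proof.
rewrite -(map_mpolyX (@ratconst k) U_(i)) -(map_mpolyX (@ratconst k) U_(j)).
rewrite -rmorphM sysderiv_const rmorphM /= !map_mpolyX.
rewrite -[tnth v i]sum_mderivX -[tnth v j]sum_mderivX mulr_suml mulr_sumr.
rewrite -[RHS](@big_split _ _ +%R); apply: eq_bigr => l _ /=.
by rewrite mderivM mulrDl mulrAC mulrA.
Qed.

Lemma invariant_coord (v : polysys k) (i : 'I_3) (c : k) g :
  tnth v i = ('X_i - (ratconst c)%:MP) * g ->
  invariant_divisor v ('X_i - (ratconst c)%:MP).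
Proof. by exists g; rewrite sysderiv_coord. Qed.

Lemma invariant_coordM (v : polysys k) (i j : 'I_3) g h :
  tnth v i = 'X_i * g -> tnth v j = 'X_j * h ->
  invariant_divisor v ('X_i * 'X_j).
Proof.
move=> vi vj; exists (g + h).
by rewrite sysderiv_coordM vi vj mulrDr mulrAC mulrA.
Qed.

End ConstantCoefficients.

(** * Factors of the right-hand sides *)

Section Naturality.
Variables (A B : comNzRingType) (phi : {rmorphism A -> B}).
Variables eta a0 a1 a2 a3 a4 x y z : A.

(** Naturality in the ring serves to evaluate: [P], [Q] and [R], written with a
    polynomial indeterminate in one slot, specialise under [horner_eval] to
    their values. *)
Lemma rmorph_D4P : phi (D4P eta a0 a1 a2 a3 a4 x y z) =
  D4P (phi eta) (phi a0) (phi a1) (phi a2) (phi a3) (phi a4)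
      (phi x) (phi y) (phi z).
Proof. by rewrite /D4P; ring. Qed.

Lemma rmorph_D4Q : phi (D4Q eta a0 a1 a2 a3 a4 x y z) =
  D4Q (phi eta) (phi a0) (phi a1) (phi a2) (phi a3) (phi a4)
      (phi x) (phi y) (phi z).
Proof. by rewrite /D4Q; ring. Qed.

Lemma rmorph_D4R : phi (D4R eta a0 a1 a2 a3 a4 x y z) =
  D4R (phi eta) (phi a0) (phi a1) (phi a2) (phi a3) (phi a4)
      (phi x) (phi y) (phi z).
Proof. by rewrite /D4R; ring. Qed.

Lemma rmorph_D4sum :
  a0 + a1 + 2 * a2 + a3 + a4 = 1 ->
  phi a0 + phi a1 + 2 * phi a2 + phi a3 + phi a4 = 1.
Proof. by move=> sum1; rewrite -[RHS](rmorph1 phi) -[in RHS]sum1; ring. Qed.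

End Naturality.

Section Factors.
Variable A : comNzRingType.
Variables eta a0 a1 a2 a3 a4 : A.

Lemma horner_factor (p : {poly A}) (a x : A) :
  p.[a] = 0 -> exists g, p.[x] = (x - a) * g.
Proof.
move=> /rootP /factor_theorem[q ->].
by exists q.[x]; rewrite hornerM hornerXsubC mulrC.
Qed.

Lemma horner_factor0 (p : {poly A}) (x : A) :
  p.[0] = 0 -> exists g, p.[x] = x * g.
Proof. by case/(horner_factor x)=> g; rewrite subr0; exists g. Qed.

(** The form to which the factor theorem applies; used in both directions, to
    introduce the polynomial and to compute its value at the expected root. *)
Lemma horner_D4P x y z :
  (D4P eta%:P a0%:P a1%:P a2%:P a3%:P a4%:P 'X y%:P z%:P).[x] =
  D4P eta a0 a1 a2 a3 a4 x y z.
Proof.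
by rewrite -horner_evalE rmorph_D4P /= !horner_evalE !hornerC hornerX.
Qed.

Lemma horner_D4Q x y z :
  (D4Q eta%:P a0%:P a1%:P a2%:P a3%:P a4%:P x%:P 'X z%:P).[y] =
  D4Q eta a0 a1 a2 a3 a4 x y z.
Proof.
by rewrite -horner_evalE rmorph_D4Q /= !horner_evalE !hornerC hornerX.
Qed.

Lemma horner_D4R x y z :
  (D4R eta%:P a0%:P a1%:P a2%:P a3%:P a4%:P x%:P y%:P 'X).[z] =
  D4R eta a0 a1 a2 a3 a4 x y z.
Proof.
by rewrite -horner_evalE rmorph_D4R /= !horner_evalE !hornerC hornerX.
Qed.

(** At [x = eta] the terms with [z] disappear through their factor [x - eta];
    the rest is a polynomial in [y] that vanishes once [alpha_3] is eliminated
    by means of the relation with [alpha_0 = 0]. *)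
Lemma D4P_factor_eta x y z :
  a0 + a1 + 2 * a2 + a3 + a4 = 1 -> a0 = 0 ->
  exists g, D4P eta a0 a1 a2 a3 a4 x y z = (x - eta) * g.
Proof.
move=> sum1 a00; rewrite -horner_D4P; apply: horner_factor; rewrite horner_D4P.
have -> : a3 = 1 - a1 - 2 * a2 - a4.
  by rewrite -[X in X - _ - _ - _]sum1 a00; ring.
by rewrite a00 /D4P; ring.
Qed.

(** At [y = 1] the terms with [z] disappear through their factor [y - 1]; the
    rest vanishes once [alpha_0] is eliminated by means of the relation with
    [alpha_3 = 0]. *)
Lemma D4Q_factor_1 x y z :
  a0 + a1 + 2 * a2 + a3 + a4 = 1 -> a3 = 0 ->
  exists g, D4Q eta a0 a1 a2 a3 a4 x y z = (y - 1) * g.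
Proof.
move=> sum1 a30; rewrite -horner_D4Q; apply: horner_factor; rewrite horner_D4Q.
have -> : a0 = 1 - a1 - 2 * a2 - a4.
  by rewrite -[X in X - _ - _ - _]sum1 a30; ring.
by rewrite a30 /D4Q; ring.
Qed.

Lemma D4R_factor_0 x y z :
  a2 = 0 -> exists g, D4R eta a0 a1 a2 a3 a4 x y z = z * g.
Proof.
move=> a20; rewrite -horner_D4R; apply: horner_factor0; rewrite horner_D4R.
by rewrite a20 /D4R; ring.
Qed.

Lemma D4P_factor_0 x y z :
  a1 = 0 -> exists g, D4P eta a0 a1 a2 a3 a4 x y z = x * g.
Proof.
move=> a10; rewrite -horner_D4P; apply: horner_factor0; rewrite horner_D4P.
by rewrite a10 /D4P; ring.
Qed.

Lemma D4Q_factor_0 x y z :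
  a4 = 0 -> exists g, D4Q eta a0 a1 a2 a3 a4 x y z = y * g.
Proof.
move=> a40; rewrite -horner_D4Q; apply: horner_factor0; rewrite horner_D4Q.
by rewrite a40 /D4Q; ring.
Qed.

End Factors.

(** * The invariant divisors *)

Theorem proposition4p3 (R : realType) (eta : R[i]) (b : ratfun R[i])
    (a0 a1 a2 a3 a4 : R[i]) :
  eta != 0 -> b != 0 ->
  a0 + a1 + 2 * a2 + a3 + a4 = 1 ->
  a4 = a1 ->
  let beta0 := a0 in let beta1 := a3 in let beta2 := a2 in let beta3 := a1 in
  let sys := D4sys eta b a0 a1 a2 a3 a4 in
  let x : {mpoly (ratfun R[i])[3]} := 'X_0 in
  let y : {mpoly (ratfun R[i])[3]} := 'X_1 in
  let z : {mpoly (ratfun R[i])[3]} := 'X_2 in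
  beta0 + beta1 + 2 * beta2 + 2 * beta3 = 1 /\
  (beta0 = 0 -> invariant_divisor sys (x - (ratconst eta)%:MP)) /\
  (beta1 = 0 -> invariant_divisor sys (y - 1)) /\
  (beta2 = 0 -> invariant_divisor sys z) /\
  (beta3 = 0 -> invariant_divisor sys (x * y)).
Proof.
move=> _ _ sum1 a41 beta0 beta1 beta2 beta3 sys x y z.
pose K : {rmorphism R[i] -> {mpoly (ratfun R[i])[3]}} :=
  @mpolyC 3 (ratfun R[i]) \o @ratconst R[i].
have Ksum := rmorph_D4sum K sum1.
have K0 (c : R[i]) : c = 0 -> K c = 0 by move=> ->; exact: (rmorph0 K).
rewrite /beta0 /beta1 /beta2 /beta3; split.
  by rewrite -[RHS]sum1 a41; ring.
pose s := b / (2 * ratconst eta).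
split=> [/K0 c0|]; [|split=> [/K0 c0|]; [|split=> [/K0 c0|a10]]].
- have [g gE] := @D4P_factor_eta _ (K eta) _ _ _ _ _ x y z Ksum c0.
  apply: (invariant_coord (g := s *: g)).
  by rewrite -scalerAr; exact: (congr1 ( *:%R s) gE).
(* [y - 1] and [z] are put in the form [w - K c], with [c = 1] and [c = 0]. *)
- have [g gE] := @D4Q_factor_1 _ (K eta) _ _ _ _ _ x y z Ksum c0.
  rewrite -(rmorph1 K); apply: (invariant_coord (g := - s *: g)).
  rewrite -scalerAr [X in _ - X](rmorph1 K).
  exact: (congr1 ( *:%R (- s)) gE).
- have [g gE] := @D4R_factor_0 _ (K eta) (K a0) (K a1) _ (K a3) (K a4) x y z c0.
  rewrite -[z]subr0 -(rmorph0 K); apply: (invariant_coord (g := s *: g)).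
  rewrite -scalerAr [X in _ - X](rmorph0 K) subr0.
  exact: (congr1 ( *:%R s) gE).
- have [g gE] := @D4P_factor_0 _ (K eta) (K a0) _ (K a2) (K a3) (K a4) x y z
    (K0 _ a10).
  have [h hE] := @D4Q_factor_0 _ (K eta) (K a0) (K a1) (K a2) (K a3) _ x y z
    (K0 _ (etrans a41 a10)).
  apply: (invariant_coordM (g := s *: g) (h := - s *: h)).
    by rewrite -scalerAr; exact: (congr1 ( *:%R s) gE).
  by rewrite -scalerAr; exact: (congr1 ( *:%R (- s)) hE).
Qed.
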